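(* Let $0<s\leq 1$. Let $I\subseteq(0,\infty)$ be an interval, let $f:I\to\mathbb{R}$ be a GA-$s$-convex function in the first sense on $I$, and let $a,b\in I$ with $a<b$. If $f\in L[a,b]$, then $$f\left(\sqrt{ab}\right)\leq \frac{1}{\ln b-\ln a}\int_a^b\frac{f(x)}{x}\,dx\leq \frac{f(a)+s f(b)}{s+1}.$$
   Context: Let $0<s\le 1$. A function $f:I\subseteq[0,\infty)\to\mathbb{R}$ is GA-$s$-convex in the first sense on $I$ if $f(x^t y^{1-t})\leq t^s f(x)+(1-t^s)f(y)$ for all $x,y\in I$ and all $t\in[0,1]$ (with $0^s=0$). $L[a,b]$ denotes the set of (Lebesgue) integrable functions on $[a,b]$. *)

(* Defs.v *)
(* MathComp-Analysis, over an arbitrary R : realType. *)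
From HB Require Import structures.
From mathcomp Require Export all_boot all_order all_algebra.
From mathcomp Require Export all_classical all_reals all_analysis.

Set Implicit Arguments.
Unset Strict Implicit.
Unset Printing Implicit Defensive.

Import Order.TTheory GRing.Theory Num.Theory.
Import numFieldNormedType.Exports.

Local Open Scope classical_set_scope.
Local Open Scope ring_scope.

(* A function I -> R is a total function R -> R whose values outside I are
   never used: when I is an interval of ]0, +oo[, the point x^t y^(1-t) lies
   between x and y, hence in I.
   powR satisfies 0 `^ s = 0 for s != 0, which is the convention 0^s = 0. *)
Definition GA_s_convex_first (R : realType) (s : R) (I : set R) (f : R -> R) :
    Prop :=
  forall x y t : R, I x -> I y -> 0 <= t <= 1 ->
    f (x `^ t * y `^ (1 - t)) <= t `^ s * f x + (1 - t `^ s) * f y.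

(* Lebesgue (and not merely Borel) measurability is intended, hence the
   completed measure: lebesgue_measure is restricted to the Borel sets. *)
Definition Lebesgue_integrable (R : realType) (a b : R) (f : R -> R) : Prop :=
  (@completed_lebesgue_measure R).-integrable `[a, b] (fun x => (f x)%:E).

(* Real-valued, hence 0 by convention when the integral of f is not finite. *)
Definition Lebesgue_integral (R : realType) (a b : R) (f : R -> R) : R :=
  \int[@completed_lebesgue_measure R]_(x in `[a, b]) f x.

(* Main.v *)
Require Import Defs.
From mathcomp Require Import all_boot all_order all_algebra.
From mathcomp Require Import all_classical all_reals all_analysis.
From mathcomp Require Import measurable_realfun ring lra.

Set Implicit Arguments.
Unset Strict Implicit.
Unset Printing Implicit Defensive.

Import Order.TTheory GRing.Theory Num.Theory.
Import numFieldNormedType.Exports.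

Local Open Scope classical_set_scope.
Local Open Scope ring_scope.

(** Put u = ln x and g = f \o expR. The weighted geometric mean x^t y^(1-t)
    becomes an arithmetic mean, so that

      g (t u + (1 - t) v) <= t^s g u + (1 - t^s) g v,

    and dx / x becomes du: the middle term of the theorem is the mean value
    of g over [ln a, ln b].

    Such a g is convex in the ordinary sense ([first_sense_convex]). The reason
    is that t <= t^s, so the bound above gives t^s >= t weight to g u: when
    g u <= g v this is at most the chord, and when g v < g u one exchanges
    u with v and t with 1 - t.

    Left inequality: a convex function lies above an affine function touching it
    at the midpoint m = (ln a + ln b) / 2 ([convex_support]), and the mean of
    that affine function over [ln a, ln b] is its value g m = f (sqrt (a b)).

    Right inequality: take u = ln a and v = ln b in the bound for g. The mean of
    t^s g (ln a) + (1 - t^s) g (ln b) over t in [0, 1] is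
    g (ln a) / (s + 1) + (s / (s + 1)) g (ln b).

    Both halves compare f x / x with a function h (ln x) / x where h is
    continuous with an explicit primitive H, whose integral is
    H (ln b) - H (ln a) by the fundamental theorem of calculus
    ([Lebesgue_integral_ln]). Hence no change of variables is applied to
    f itself. *)

Section HermiteHadamard.
Context {R : realType}.
Local Notation mu := (@lebesgue_measure R).
Local Notation cmu := (@completed_lebesgue_measure R).

(** * From Borel measurability to the completed Lebesgue measure *)

Lemma completed_measurable (D : set R) : measurable D ->
  measurable (D : set (caratheodory_type (wlength (@idfun R))^*%mu)).
Proof. exact: sub_caratheodory. Qed.

Lemma measurable_fun_completed d (U : measurableType d) (D : set R)
    (h : R -> U) :
  measurable D -> measurable_fun D h ->
  @measurable_fun _ _ (caratheodory_type (wlength (@idfun R))^*%mu) _ D h.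
Proof.
by move=> mD mh _ Y mY; apply: sub_caratheodory; exact: mh.
Qed.

(** The Lebesgue measure is the image of its completion under the identity,
    seen as a measurable map from the completed to the Borel sigma-algebra. *)
Lemma ge0_integral_completed (D : set R) (h : R -> \bar R) :
  measurable D -> measurable_fun D h -> (forall x, D x -> (0 <= h x)%E) ->
  (\int[cmu]_(x in D) h x = \int[mu]_(x in D) h x)%E.
Proof.
move=> mD mh h0.
pose phi : caratheodory_type (wlength (@idfun R))^*%mu ->
  measurableTypeR R := id.
have mphi : measurable_fun setT phi.
  by move=> _ Y mY; rewrite setTI; exact: sub_caratheodory.
have -> : (\int[cmu]_(x in D) h x = \int[pushforward cmu phi]_(y in D) h y)%E.
  by rewrite (ge0_integral_pushforward mphi)// => x /set_mem /h0.
exact: eq_measure_integral.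
Qed.

Lemma integrable_completed (D : set R) (h : R -> \bar R) :
  measurable D -> mu.-integrable D h -> cmu.-integrable D h.
Proof.
move=> mD /integrableP[mh hoo]; apply/integrableP; split.
  exact: measurable_fun_completed.
rewrite ge0_integral_completed//; exact: measurableT_comp.
Qed.

Lemma integral_completed (D : set R) (h : R -> \bar R) :
  measurable D -> measurable_fun D h ->
  (\int[cmu]_(x in D) h x = \int[mu]_(x in D) h x)%E.
Proof.
move=> mD mh; rewrite integralE [RHS]integralE.
rewrite !ge0_integral_completed//.
  exact: measurable_funeneg.
exact: measurable_funepos.
Qed.

(** * Powers of the absolute value *)

(** For s > 0, [u `^ s] is 1 for u < 0 and 0 at u = 0. Replacing u by its
    absolute value makes it continuous at 0, which the parameter t of the right
    inequality reaches at the endpoint x = b. *)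
Lemma is_derive_normr_powR (s t : R) : 0 < t ->
  is_derive t 1 (fun u => `|u| `^ s) (s * t `^ (s - 1)).
Proof.
move=> t0; apply: (@near_eq_is_derive R R R (fun u => u `^ s)
  (fun u => `|u| `^ s) t 1); last exact: is_derive1_powR.
by near=> u; rewrite ger0_norm// ltW//; near: u; exact: lt_nbhsr.
Unshelve. end_near. Qed.

Lemma continuous_normr_powR (s : R) : 0 < s ->
  continuous (fun u : R => `|u| `^ s).
Proof.
move=> s0 t; have [->|t0] := eqVneq t 0.
  apply/cvgrPdist_lt => e e0; near=> u.
  rewrite normr0 powR0 ?gt_eqF// sub0r normrN ger0_norm ?powR_ge0//.
  (* |u|^s < e amounts to |u| < e^(1/s). *)
  have -> : e = (e `^ s^-1) `^ s.
    by rewrite -powRrM mulVf ?gt_eqF// powRr1// ltW.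
  apply: gt0_ltr_powR => //; rewrite ?nnegrE ?powR_ge0//.
  near: u; apply: (@nbhs0_lt R R); exact: powR_gt0.
have t1 : 0 < `|t| by rewrite normr_gt0.
apply: (@cvg_comp R R R Num.norm (fun u => u `^ s) _ (nbhs `|t|)).
  exact: norm_continuous.
have /derivable1_diffP/differentiable_continuous :
    derivable (fun u : R => u `^ s) `|t| 1.
  by apply: derivable_powR; rewrite in_itv/= t1.
exact.
Unshelve. end_near. Qed.

(** * Convexity *)

Definition convex_on (g : R -> R) (A B : R) :=
  forall u v t, A <= u <= B -> A <= v <= B -> 0 <= t <= 1 ->
  g (t * u + (1 - t) * v) <= t * g u + (1 - t) * g v.

(** The slope k is the supremum of the slopes of the chords ending at m. Each of
    them is at most the slope of any chord starting at m, so the supremum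
    exists and separates the two families. *)
Lemma convex_support (g : R -> R) (A B m : R) : A < m < B -> convex_on g A B ->
  exists k, forall u, A <= u <= B -> g m + k * (u - m) <= g u.
Proof.
move=> /andP[Am mB] gc.
have slope u v : A <= u < m -> m < v <= B ->
    (g m - g u) / (m - u) <= (g v - g m) / (v - m).
  move=> /andP[Au um] /andP[mv vB].
  have uv : 0 < v - u by lra.
  have vu : v - u != 0 by rewrite gt_eqF.
  have t01 : 0 <= (v - m) / (v - u) <= 1.
    rewrite divr_ge0 ?(ltW uv)//=; last by lra.
    by rewrite ler_pdivrMr//; lra.
  have := gc u v _ _ _ t01.
  rewrite (_ : (v - m) / (v - u) * u + (1 - (v - m) / (v - u)) * v = m);
    last by field.
  move=> /(_ ltac:(lra) ltac:(lra)) H.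
  rewrite ler_pdivrMr ?subr_gt0// mulrAC ler_pdivlMr ?subr_gt0//.
  have : g m * (v - u) <= (v - m) * g u + (m - u) * g v.
    rewrite -ler_pdivlMr//; apply: (le_trans H).
    by rewrite le_eqVlt; apply/orP; left; apply/eqP; field.
  lra.
pose S := [set (g m - g u) / (m - u) | u in [set u | A <= u < m]].
have S0 : S !=set0.
  by exists ((g m - g A) / (m - A)); exists A => //=; rewrite lexx.
have ubS v : m < v <= B -> ubound S ((g v - g m) / (v - m)).
  by move=> hv _ [u hu <-]; exact: slope.
exists (sup S) => u /andP[Au uB].
have [um|mu|->] := ltgtP u m.
- have : (g m - g u) / (m - u) <= sup S.
    apply: ub_le_sup; last by exists u => //=; rewrite Au.
    by exists ((g B - g m) / (B - m)); apply: ubS; rewrite mB lexx.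
  rewrite ler_pdivrMr ?subr_gt0//; lra.
- have : sup S <= (g u - g m) / (u - m).
    by apply: ge_sup => //; apply: ubS; rewrite mu.
  rewrite ler_pdivlMr ?subr_gt0//; lra.
- by rewrite subrr mulr0 addr0.
Qed.

(** * Integrals of functions of ln x against dx / x *)

(** G \o ln is a primitive of g (ln x) / x. At the endpoints continuity
    suffices, so that G may involve a power of |ln b - u|, whose derivative is
    computed for u < ln b only. *)
Lemma integral_ln (g G : R -> R) (a b : R) : 0 < a -> a < b ->
  continuous g -> continuous G ->
  (forall u, ln a < u < ln b -> is_derive u 1 G (g u)) ->
  (@lebesgue_measure R).-integrable `[a, b] (fun x => (g (ln x) / x)%:E) /\
  (\int[@lebesgue_measure R]_(x in `[a, b]) (g (ln x) / x)%:E =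
   (G (ln b) - G (ln a))%:E)%E.
Proof.
move=> a0 ab cg cG dG; have b0 := lt_trans a0 ab.
have cln (h : R -> R) (x : R) : continuous h -> 0 < x ->
    {for x, continuous (h \o @ln R)}.
  by move=> ch x0; apply: continuous_comp; [exact: continuous_ln|exact: ch].
have cont : {within `[a, b], continuous (fun x => g (ln x) / x)}.
  apply: continuous_in_subspaceT => x; rewrite inE/= in_itv/= => /andP[ax _].
  have x0 := lt_le_trans a0 ax.
  apply: cvgM; last by apply: cvgV; [rewrite gt_eqF|exact: cvg_id].
  exact: cln.
split.
  by apply: continuous_compact_integrable => //; exact: segment_compact.
rewrite EFinB; apply: (@continuous_FTC2 _ _ (G \o @ln R)) => //.
- split.
  + move=> x; rewrite in_itv/= => /andP[ax xb].
    have x0 := lt_trans a0 ax.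
    have h : ln a < ln x < ln b by rewrite !ltr_ln ?posrE ?ax ?xb.
    by have [] := is_derive1_comp (dG _ h) (is_derive1_ln x0).
  + by apply: cvg_at_right_filter; exact: cln.
  + by apply: cvg_at_left_filter; apply: cln => //; exact: lt_trans ab.
- move=> x; rewrite in_itv/= => /andP[ax xb].
  have x0 := lt_trans a0 ax.
  have h : ln a < ln x < ln b by rewrite !ltr_ln ?posrE ?ax ?xb.
  by have [_] := is_derive1_comp (dG _ h) (is_derive1_ln x0); rewrite derive1E.
Qed.

Lemma Lebesgue_integral_ln (g G : R -> R) (a b : R) : 0 < a -> a < b ->
  continuous g -> continuous G ->
  (forall u, ln a < u < ln b -> is_derive u 1 G (g u)) ->
  Lebesgue_integrable a b (fun x => g (ln x) / x) /\
  Lebesgue_integral a b (fun x => g (ln x) / x) = G (ln b) - G (ln a).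
Proof.
move=> a0 ab cg cG dG; have [ig eg] := integral_ln a0 ab cg cG dG.
split; first by apply: integrable_completed.
rewrite /Lebesgue_integral /Rintegral integral_completed ?eg//.
exact: (measurable_int _ ig).
Qed.

(** On [a, b] the factor 1 / x is continuous and bounded by 1 / a. *)
Lemma Lebesgue_integrable_div (f : R -> R) (a b : R) : 0 < a ->
  Lebesgue_integrable a b f -> Lebesgue_integrable a b (fun x => f x / x).
Proof.
move=> a0 fi; rewrite /Lebesgue_integrable.
apply: (integrableMl (completed_measurable _) fi (h := fun x => x^-1)).
- by [].
- apply: measurable_fun_completed => //.
  apply: subspace_continuous_measurable_fun => //.
  apply: continuous_in_subspaceT => x; rewrite inE/= in_itv/= => /andP[ax _].
  by apply: inv_continuous; rewrite gt_eqF// (lt_le_trans a0).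
- exists a^-1; split; first exact: num_real.
  move=> M aM x /=; rewrite in_itv/= => /andP[ax _].
  have x0 := lt_le_trans a0 ax.
  by rewrite ger0_norm ?invr_ge0 ?ltW// (le_lt_trans _ aM)// lef_pV2.
Qed.

Lemma le_Lebesgue_integral (f1 f2 : R -> R) (a b : R) :
  Lebesgue_integrable a b f1 -> Lebesgue_integrable a b f2 ->
  (forall x, a <= x <= b -> f1 x <= f2 x) ->
  Lebesgue_integral a b f1 <= Lebesgue_integral a b f2.
Proof.
move=> i1 i2 f12; apply: le_Rintegral => //; exact: completed_measurable.
Qed.

(** * s-convexity in the logarithmic variable *)

Lemma GA_s_convex_first_expR (s : R) (I : set R) (f : R -> R) :
  GA_s_convex_first s I f ->
  forall u v t, I (expR u) -> I (expR v) -> 0 <= t <= 1 ->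
  f (expR (t * u + (1 - t) * v)) <=
    t `^ s * f (expR u) + (1 - t `^ s) * f (expR v).
Proof.
move=> hf u v t Iu Iv t01; have := hf _ _ _ Iu Iv t01.
have expRX r w : expR w `^ r = expR (r * w :> R).
  by rewrite /powR gt_eqF ?expR_gt0// expRK.
by rewrite !expRX -expRD.
Qed.

Lemma le_powR_le1 (s t : R) : 0 < s <= 1 -> 0 <= t <= 1 -> t <= t `^ s.
Proof.
move=> /andP[s0 s1] /andP[]; rewrite le_eqVlt => /predU1P[<- _|t0 t1].
  by rewrite powR0// gt_eqF.
have : t `^ 1 <= t `^ s by apply: ger_powR; rewrite ?t0.
by rewrite powRr1// ltW.
Qed.

(** Since t <= t^s, the hypothesis puts at least the weight t on g u. This is
    enough when g u <= g v; otherwise the hypothesis is used with u and v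
    exchanged and 1 - t in place of t. *)
Lemma first_sense_convex (s : R) (g : R -> R) (A B : R) : 0 < s <= 1 ->
  (forall u v t, A <= u <= B -> A <= v <= B -> 0 <= t <= 1 ->
    g (t * u + (1 - t) * v) <= t `^ s * g u + (1 - t `^ s) * g v) ->
  convex_on g A B.
Proof.
move=> s01 gs u v t hu hv t01.
have t01' : 0 <= 1 - t <= 1 by lra.
have [guv|gvu] := leP (g u) (g v).
  apply: (le_trans (gs _ _ _ hu hv t01)).
  have := le_powR_le1 s01 t01; nra.
have := gs _ _ _ hv hu t01'; rewrite (_ : 1 - (1 - t) = t); last by ring.
rewrite addrC => /le_trans; apply.
have := le_powR_le1 s01 t01'; nra.
Qed.

(** * Primitives of the two comparison functions *)

(** With t = (B - v) / L, a primitive of t^s in the variable v is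
    - (L / (s + 1)) t^(s + 1). *)
Lemma is_derive_power_primitive (s B L c d u : R) : 0 < s -> 0 < L -> u < B ->
  is_derive u 1 (fun v => d * v - c * (L / (s + 1)) * `|(B - v) / L| `^ (s + 1))
    (d + c * `|(B - u) / L| `^ s).
Proof.
move=> s0 L0 uB.
have t0 : 0 < (B - u) / L by rewrite divr_gt0// subr_gt0.
have dt : is_derive u 1 (fun v => (B - v) / L) (- L^-1).
  apply: is_derive_eq; rewrite /GRing.scale/=; ring.
have := @is_derive1_comp R (fun t => `|t| `^ (s + 1))
  (fun v => (B - v) / L) u _ _ (is_derive_normr_powR (s + 1) t0) dt.
rewrite addrK => dp.
have -> : d + c * `|(B - u) / L| `^ s =
  d * 1 - c * (L / (s + 1)) * ((s + 1) * ((B - u) / L) `^ s * - L^-1).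
  rewrite gtr0_norm//; field; rewrite !gt_eqF//=; lra.
have d1 : is_derive u 1 (fun v => d * v) (d * 1) by exact: is_deriveZ.
exact: (is_deriveB d1 (is_deriveZ (c * (L / (s + 1))) dp)).
Qed.

Lemma is_derive_affine_primitive (c k m u : R) :
  is_derive u 1 (fun v => c * v + k / 2 * (v - m) ^+ 2) (c + k * (u - m)).
Proof.
by apply: is_derive_eq; rewrite /GRing.scale/=; field.
Qed.

End HermiteHadamard.

Theorem theorem6 (R : realType) (s : R) (I : set R) (f : R -> R) (a b : R)
    (hs : 0 < s <= 1)
    (hI : is_interval I) (hI0 : I `<=` `]0, +oo[)
    (hf : GA_s_convex_first s I f)
    (ha : I a) (hb : I b) (hab : a < b)
    (hfL : Lebesgue_integrable a b f) :
  f (Num.sqrt (a * b)) <=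
    (ln b - ln a)^-1 * Lebesgue_integral a b (fun x => f x / x) <=
    (f a + s * f b) / (s + 1).
Proof.
have s0 : 0 < s by case/andP: hs.
have a0 : 0 < a by have := hI0 _ ha; rewrite /= in_itv/= andbT.
have b0 : 0 < b := lt_trans a0 hab.
have lnaK : expR (ln a) = a by rewrite lnK.
have lnbK : expR (ln b) = b by rewrite lnK.
have AB : ln a < ln b by rewrite ltr_ln.
have L0 : 0 < ln b - ln a by rewrite subr_gt0.
have ln_ab x : a <= x <= b ->
    [/\ 0 < x, expR (ln x) = x & ln a <= ln x <= ln b].
  move=> /andP[ax xb]; have x0 : 0 < x := lt_le_trans a0 ax.
  by split=> //; [rewrite lnK|rewrite !ler_ln// ax].
have Iexp u : ln a <= u <= ln b -> I (expR u).
  move=> /andP[Au uB]; apply: (hI a b) => //.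
  by rewrite -{1}lnaK -lnbK !ler_expR Au.
have gs := GA_s_convex_first_expR hf.
have fi := Lebesgue_integrable_div a0 hfL.
rewrite [_^-1 * _]mulrC; apply/andP; split.
- (* The supporting line g is integrated against dx / x; the quadratic
     part of its primitive G takes the same value at both endpoints. *)
  set m := (ln a + ln b) / 2.
  have -> : Num.sqrt (a * b) = expR m.
    rewrite -lnaK -lnbK -expRD.
    have -> : ln a + ln b = m + m by rewrite /m; field.
    by rewrite expRD -expr2 sqrtr_sqr ger0_norm ?expR_ge0.
  have gc : convex_on (f \o expR) (ln a) (ln b).
    by apply: (first_sense_convex hs) => u v t hu hv; apply: gs; exact: Iexp.
  have [|k hk] := convex_support (m := m) _ gc; first by rewrite /m; lra.
  pose g u := f (expR m) + k * (u - m).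
  pose G u := f (expR m) * u + k / 2 * (u - m) ^+ 2.
  have cg : continuous g.
    move=> u; apply: cvgD; first exact: cvg_cst.
    by apply: cvgMr; apply: cvgB; [exact: cvg_id|exact: cvg_cst].
  have dG (u : R) : is_derive u 1 G (g u) :=
    is_derive_affine_primitive (f (expR m)) k m u.
  have cG : continuous G.
    move=> u; apply/differentiable_continuous/derivable1_diffP.
    by have [] := dG u.
  have [gi ge] := Lebesgue_integral_ln a0 hab cg cG (fun u _ => dG u).
  rewrite ler_pdivlMr//.
  have -> : f (expR m) * (ln b - ln a) = G (ln b) - G (ln a).
    by rewrite /G /m; field.
  rewrite -ge; apply: le_Lebesgue_integral => // x /ln_ab[x0 lnxK hx].
  by rewrite ler_pM2r ?invr_gt0//; have := hk _ hx; rewrite /= lnxK.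
- (* g (ln x) is t^s f a + (1 - t^s) f b for x = a^t b^(1-t). *)
  pose g u := f b + (f a - f b) * `|(ln b - u) / (ln b - ln a)| `^ s.
  pose G u := f b * u - (f a - f b) * ((ln b - ln a) / (s + 1)) *
    `|(ln b - u) / (ln b - ln a)| `^ (s + 1).
  have cp (r : R) : 0 < r ->
      continuous (fun u : R => `|(ln b - u) / (ln b - ln a)| `^ r).
    move=> r0 u.
    apply: (@cvg_comp R R R (fun u => (ln b - u) / (ln b - ln a))
      (fun t => `|t| `^ r) _ (nbhs ((ln b - u) / (ln b - ln a))));
      last exact: continuous_normr_powR.
    by apply: cvgMl; apply: cvgB; [exact: cvg_cst|exact: cvg_id].
  have cg : continuous g.
    by move=> u; apply: cvgD; [exact: cvg_cst|apply: cvgMr; exact: cp].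
  have cG : continuous G.
    move=> u; apply: cvgB; apply: cvgMr; [exact: cvg_id|apply: cp; lra].
  have dG (u : R) : ln a < u < ln b -> is_derive u 1 G (g u).
    by move=> /andP[_ uB]; exact: is_derive_power_primitive.
  have [gi ge] := Lebesgue_integral_ln a0 hab cg cG dG.
  rewrite ler_pdivrMr//.
  have -> : (f a + s * f b) / (s + 1) * (ln b - ln a) = G (ln b) - G (ln a).
    rewrite /G subrr mul0r normr0 powR0 ?gt_eqF//; last by lra.
    rewrite divff ?gt_eqF// normr1 powR1; field; rewrite gt_eqF//; lra.
  rewrite -ge; apply: le_Lebesgue_integral => // x /ln_ab[x0 lnxK /andP[Ax xB]].
  rewrite ler_pM2r ?invr_gt0//.
  set t := (ln b - ln x) / (ln b - ln a).
  have t01 : 0 <= t <= 1.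
    by rewrite ler_pdivrMr// ler_pdivlMr// mul0r mul1r subr_ge0 xB lerD2l lerN2.
  have := gs (ln a) (ln b) t; rewrite lnaK lnbK => /(_ ha hb t01).
  have -> : t * ln a + (1 - t) * ln b = ln x.
    by rewrite /t; field; rewrite gt_eqF.
  rewrite lnxK /g -/t ger0_norm; last by case/andP: t01.
  move=> /le_trans; apply; rewrite le_eqVlt; apply/orP; left.
  by apply/eqP; ring.
Qed.
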